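(* Assume that a sequence $\{(X_n,d_n,\mu_n)\}_{n=1}^{\infty}$ of mm-spaces is a L\'evy family, with $m_n=\mu_n(X_n)$. Then, for any $\kappa>0$, we have $$\sup\{\operatorname{diam}(X_n\stackrel{\mathrm{Lip}_1}{\longrightarrow}T,m_n-\kappa)\mid T\text{ is a tree}\}\to 0\quad\text{as } n\to\infty.$$
   Context: An mm-space is a triple $(X,d,\mu)$ where $d$ is a complete separable metric on the set $X$ and $\mu$ is a finite Borel measure on $(X,d)$; its total measure is $m=\mu(X)$. For a finite Borel measure $\nu$ on a metric space $Y$ with $m=\nu(Y)$ and $\kappa>0$, the partial diameter is $\operatorname{diam}(\nu,m-\kappa):=\inf\{\operatorname{diam} Y_0\mid Y_0\subseteq Y \text{ Borel},\ \nu(Y_0)\ge m-\kappa\}$. For an mm-space $X$ with total measure $m$, a metric space $Y$ and $\kappa>0$, the observable diameter is $\operatorname{diam}(X\stackrel{\mathrm{Lip}_1}{\longrightarrow}Y,m-\kappa):=\sup\{\operatorname{diam}(f_*(\mu),m-\kappa)\mid f:X\to Y \text{ is a 1-Lipschitz map}\}$. A sequence $\{X_n\}$ of mm-spaces is a L\'evy family if $\operatorname{diam}(X_n\stackrel{\mathrm{Lip}_1}{\longrightarrow}\mathbb{R},m_n-\kappa)\to0$ as $n\to\infty$ for every $\kappa>0$. A tree is a (possibly infinite) connected combinatorial graph having no loops (cycles); its individual edges are identified with bounded closed intervals of the real line, and the distance between two points of the tree is the infimum of the lengths of paths joining them. *)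

(* Defs.v *)
From HB Require Import structures.
From mathcomp Require Import all_boot all_order all_algebra.
From mathcomp Require Import all_classical all_reals all_analysis.

Set Implicit Arguments.
Unset Strict Implicit.
Unset Printing Implicit Defensive.

Import Order.TTheory GRing.Theory Num.Theory.
Import numFieldNormedType.Exports.

Local Open Scope classical_set_scope.
Local Open Scope ring_scope.

#[short(type="completeMetricType")]
HB.structure Definition CompleteMetric (R : numDomainType) :=
  { T of Complete T & Metric R T }.

Definition separable (T : topologicalType) : Prop :=
  exists2 D : set T, countable D & dense D.

Definition borel (T : topologicalType) : set (set T) := <<s @open T >>.

Record mm_space (R : realType) := MMSpace {
  mm_carrier :> completeMetricType R;
  mm_separable : separable mm_carrier;
  mm_measure :
    {finite_measure set (g_sigma_algebraType (@open mm_carrier)) -> \bar R}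
}.

Definition lipschitz1 (R : realType) (X Y : metricType R) (f : X -> Y) : Prop :=
  forall x y, mdist (f x) (f y) <= mdist x y.

(* The explicit 0 is the convention diam set0 = 0 (ereal_sup set0 is -oo); it
   changes nothing on nonempty sets. *)
Definition diam (R : realType) (Y : metricType R) (A : set Y) : \bar R :=
  ereal_sup (0%E |` [set (mdist x y)%:E | x in A & y in A]).

(* diam(nu, m - kappa) with m = nu(Y) *)
Definition partial_diam (R : realType) (Y : metricType R)
    (nu : set Y -> \bar R) (kappa : R) : \bar R :=
  ereal_inf [set diam A | A in
    [set A | borel A /\ (nu setT - kappa%:E <= nu A)%E]].

(* diam(X -> Y, m - kappa) over 1-Lipschitz maps, m the total measure of X.
   The set function passed to partial_diam is the pushforward of the measure;
   [pushforward] itself would require Y to be pointed. *)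
Definition obs_diam (R : realType) (X : mm_space R) (Y : metricType R)
    (kappa : R) : \bar R :=
  ereal_sup [set partial_diam (fun A => mm_measure X (f @^-1` A)) kappa
            | f in [set f : X -> Y | lipschitz1 f]].

Definition levy_family (R : realType) (X : nat -> mm_space R) : Prop :=
  forall kappa : R, 0 < kappa ->
    obs_diam (X n) (R^o : metricType R) kappa @[n --> \oo] --> 0%E.

(* A simple graph has no loop edges or multiple edges, so its cycles are the
   duplicate-free cyclic sequences of at least three vertices: a sequence
   [:: x; y] with e x y only goes back and forth along one edge. *)
Record combinatorial_tree (V : choiceType) (e : rel V) : Prop :=
  CombinatorialTree {
  tree_sym : symmetric e;
  tree_irr : irreflexive e;
  tree_nonempty : [set: V] !=set0;
  tree_connected : forall x y, exists2 p, path e x p & last x p = y;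
  tree_acyclic : forall c, cycle e c -> uniq c -> (size c <= 2)%N
}.

Section Realization.
Variables (R : realType) (V : choiceType) (e : rel V) (len : V -> V -> R).
Variables (T : Type) (vtx : V -> T) (pt : V -> V -> R -> T).

(* [pt u v t] is the point at position t of the edge from u to v, identified
   with `[0, len u v]; only the values with e u v and t in that interval are
   relevant. Each edge is described in both directions. *)

(* Paths from x to y with their length: concatenations of finitely many
   segments, each contained in one closed edge. *)
Inductive tree_path : T -> T -> R -> Prop :=
| TreePathNil x : tree_path x x 0
| TreePathCons u v s t y l :
    e u v -> s \in `[0, len u v] -> t \in `[0, len u v] ->
    tree_path (pt u v t) y l -> tree_path (pt u v s) y (`|s - t| + l).

(* T is, as a set, the disjoint union of the edges with their end points
   identified according to the graph. *)
Record tree_gluing : Prop := TreeGluing {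
  len_gt0 : forall u v, e u v -> 0 < len u v;
  len_sym : forall u v, e u v -> len v u = len u v;
  pt_rev : forall u v t, e u v -> t \in `[0, len u v] ->
    pt v u (len u v - t) = pt u v t;
  pt_0 : forall u v, e u v -> pt u v 0 = vtx u;
  vtx_inj : injective vtx;
  pt_inj : forall u v s u' v' t, e u v -> e u' v' ->
    s \in `]0, len u v[ -> t \in `[0, len u' v'] -> pt u v s = pt u' v' t ->
    (u', v', t) = (u, v, s) \/ (u', v', t) = (v, u, len u v - s);
  pt_surj : forall x, (exists u, x = vtx u) \/
    (exists u v t, [/\ e u v, t \in `[0, len u v] & x = pt u v t])
}.

End Realization.

Definition is_tree (R : realType) (T : metricType R) : Prop :=
  exists (V : choiceType) (e : rel V) (len : V -> V -> R)
         (vtx : V -> T) (pt : V -> V -> R -> T),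
    [/\ combinatorial_tree e, tree_gluing e len vtx pt &
        forall x y : T, mdist x y = inf [set l | tree_path e len pt x y l]].

(* Main.v *)
From HB Require Import structures.
Require Import Defs.
From mathcomp Require Import all_boot all_order all_algebra.
From mathcomp Require Import all_classical all_reals all_analysis.
From mathcomp Require Import lra zify.

Set Implicit Arguments.
Unset Strict Implicit.
Unset Printing Implicit Defensive.

Import Order.TTheory GRing.Theory Num.Theory.
Import numFieldNormedType.Exports.
Local Open Scope classical_set_scope.
Local Open Scope ring_scope.

(** Root the tree T at a vertex and let h be the height above the root. A point
    x with h x >= t has a foot p t x, the point at height t on the way down from
    x to the root (the root itself when t <= 0). It satisfies
    d(x, p t x) <= h x - t, and since T has no cycles the foot does not change
    along a path that stays above the level t; so two points with different feet
    are joined only by descending to that level, and their distance is at least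
    (h x - t) + (h y - t). These properties ([hanging], [is_tree_hanging]) are
    all that is used of a tree.

    Let f : X -> T be 1-Lipschitz, where the 1-Lipschitz functions on X
    concentrate up to mass k on sets where they oscillate by less than eps.
    Applied to h o f, this gives a set S of almost full mass on which h o f is
    within eps of some value; let t lie 2 eps below that value. The feet p t (f x)
    cut S into branches. For any set L of feet, the function equal to
    (h y - t)^+ on the branches with foot in L and to - (h y - t)^+ on the
    others is 1-Lipschitz ([signed_height_lipschitz]), because it vanishes at
    the level t. On S its composite with f takes values above eps or below
    - eps, so by concentration one of the two groups of branches has mass at
    most k.

    Branches are 2 eps apart in X, so by separability there are countably many.
    Adding them one at a time, the first one that brings the total above k has
    all but 2 k of the mass of S ([exhaustion_big_step]). Points of T between the
    levels t and t + 4 eps with the same foot are at distance at most 8 eps,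
    whence diam(f_* mu, m - 3 k) <= 8 eps for every tree T and every f
    ([hanging_partial_diam]).

    The supremum over trees is also nonnegative: a supremum over the empty set
    would be -oo, so a tree must be exhibited, and one point is enough
    ([one_point_is_tree]). *)

(** * Simple paths in a combinatorial tree *)

Section Graph.
Context {V : choiceType} {e : rel V} (tree_e : combinatorial_tree e).
Implicit Types (u v x y : V) (p q : seq V).

(** Split [p] at its first element that belongs to [q]. *)
Lemma first_hit p q : has (mem q) p ->
  exists p1 z p2, [/\ p = p1 ++ z :: p2, z \in q & ~~ has (mem q) p1].
Proof.
elim: p => //= a p IH.
have [aq _|aq /= /IH [p1 [z [p2 [-> zq p1q]]]]] := boolP (a \in q).
  by exists [::], a, p.
by exists (a :: p1), z, p2; rewrite /= negb_or aq.
Qed.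

(** In a tree, a simple path is determined by its end points. *)
Lemma simple_path_unique x p q : path e x p -> path e x q ->
  uniq (x :: p) -> uniq (x :: q) -> last x p = last x q -> p = q.
Proof.
have [esym _ _ _ acyc] := tree_e.
elim: p x q => [|a p IH] x [|b q] //=.
- by move=> _ _ _ /andP[/negP xq _] xl; case: xq; rewrite xl mem_last.
- by move=> _ _ /andP[/negP xp _] _ xl; case: xp; rewrite -xl mem_last.
move=> /andP[xa ap] /andP[xb bq] /andP[xNp up] /andP[xNq uq] pq.
have [ab|ab] := eqVneq a b.
  by rewrite -ab in bq uq pq *; congr (_ :: _); exact: IH bq up uq pq.
have hit : has (mem (b :: q)) (a :: p).
  apply/hasP; exists (last a p); first exact: mem_last.
  by rewrite pq /= mem_last.
have [p1 [z [p2 [ap_eq zq p1q]]]] := first_hit hit.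
case/path.splitPr def_bq : _ / zq => [q1 q2].
have xap : path e x (a :: p) by rewrite /= xa.
have xbq : path e x (b :: q) by rewrite /= xb.
have upp : uniq (x :: a :: p) by rewrite cons_uniq xNp.
have uqq : uniq (x :: b :: q) by rewrite cons_uniq xNq.
rewrite ap_eq in xap upp; rewrite def_bq in xbq uqq p1q.
(* The two paths first part at x and first meet again at z. *)
pose c := x :: p1 ++ z :: rev q1.
have cyc : cycle e c.
  move: xap xbq; rewrite /c /= rcons_cat rcons_cons !cat_path /=.
  move=> /and3P[-> -> _] /and3P[xq1 q1z _] /=.
  have := rev_path e x (rcons q1 z); rewrite last_rcons belast_rcons.
  rewrite rev_cons => ->.
  rewrite (@eq_path _ _ e); last by move=> ? ?; rewrite esym.
  by rewrite rcons_path xq1.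
have uc : uniq c.
  move: upp uqq p1q; rewrite /c !cons_uniq !cat_uniq !cons_uniq.
  rewrite !mem_cat !inE !mem_rev !rev_uniq !negb_or.
  move=> /andP[/and3P[-> -> _] /and3P[-> zp1 _]].
  move=> /andP[/and3P[-> _ _] /and3P[-> zq1 _]].
  case/andP: zp1 => -> _; case/andP: zq1 => -> _.
  move=> p1q; suff -> : ~~ has (mem p1) (rev q1) by [].
  apply/hasPn => w; rewrite mem_rev => wq1; apply/negP => wp1.
  by move/hasPn: p1q => /(_ w wp1); rewrite /= mem_cat wq1.
have := acyc _ cyc uc; rewrite /c /= size_cat /= size_rev addnS !ltnS leqn0.
rewrite addn_eq0 !size_eq0 => /andP[/eqP p10 /eqP q10].
move: ap_eq def_bq ab; rewrite p10 q10 /= => -[-> _] [-> _].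
by rewrite eqxx.
Qed.


(** [c] maps each vertex [v] to the simple path from [v] to the root [r],
    without its starting point: the sequence of the ancestors of [v]. *)
Definition ancestry (r : V) (c : V -> seq V) : Prop :=
  forall v, [/\ path e v (c v), uniq (v :: c v) & last v (c v) = r].

Lemma exists_ancestry r : exists c, ancestry r c.
Proof.
have [_ _ _ conn _] := tree_e.
suff /choice[c cP] : forall v, exists p,
    [/\ path e v p, uniq (v :: p) & last v p = r] by exists c.
move=> v; have [p ep <-] := conn v r.
by have [p' ep' up' _] := shortenP ep; exists p'.
Qed.

Section Ancestry.
Context {r : V} {c : V -> seq V} (c_anc : ancestry r c).

Lemma ancestry_unique v p :
  path e v p -> uniq (v :: p) -> last v p = r -> c v = p.
Proof.
move=> ep up pr; have [ec uc cr] := c_anc v.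
by apply: simple_path_unique ec ep uc up _; rewrite cr pr.
Qed.

Lemma ancestry_cons v u s : c v = u :: s -> e v u /\ c u = s.
Proof.
move=> cv; have := c_anc v; rewrite cv /= => -[/andP[evu es] /andP[_ us] sr].
by split=> //; exact: ancestry_unique.
Qed.

Lemma ancestry_nil v : c v = [::] -> v = r.
Proof. by move=> cv; have [_ _] := c_anc v; rewrite cv. Qed.

(** Of two adjacent vertices, one is the parent of the other. *)
Lemma ancestry_edge u v : e u v -> c v = u :: c u \/ c u = v :: c v.
Proof.
have [esym eirr _ _ acyc] := tree_e.
move=> euv; have [ec uc cr] := c_anc u.
have [|vu] := boolP (v \in u :: c u); last first.
  left; apply: ancestry_unique => //; first by rewrite /= esym euv.
  by rewrite cons_uniq vu.
rewrite inE => /orP[/eqP vu|vc]; first by rewrite vu eirr in euv.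
right; case/path.splitPr def_c : _ / vc => [p1 p2].
have -> : c v = p2.
  move: ec uc cr; rewrite def_c cat_path cons_uniq cat_uniq last_cat /=.
  move=> /and3P[_ _ ep2] /andP[_ /and3P[_ _ up2]] p2r.
  exact: ancestry_unique.
(* Otherwise the path from u to v is closed by the edge into a cycle. *)
suff -> : p1 = [::] by [].
have cyc : cycle e (u :: rcons p1 v).
  move: ec; rewrite def_c /= -cat_rcons cat_path => /andP[ep _].
  by rewrite rcons_path ep last_rcons esym.
have ucyc : uniq (u :: rcons p1 v).
  move: uc; rewrite def_c -cat_rcons -cat_cons cat_uniq.
  by case/and3P.
by have := acyc _ cyc ucyc; rewrite /= size_rcons !ltnS leqn0 => /nilP.
Qed.

End Ancestry.
End Graph.

(** * Heights and feet in a metric tree *)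

(** A metric space hangs from a height function [h] when each point [x] of
    height at least [t] has a foot [p t x] at distance at most [h x - t], and
    two points with different feet can only be joined by descending to the
    level [t]. *)
Definition hanging (R : realType) (T : metricType R) (h : T -> R)
    (p : R -> T -> T) : Prop :=
  [/\ forall x y, `|h x - h y| <= mdist x y,
      forall t x, t <= h x -> mdist x (p t x) <= h x - t &
      forall t x y, t <= h x -> t <= h y -> p t x <> p t y ->
        h x - t + (h y - t) <= mdist x y].

Section TreeHanging.
Context {R : realType} {T : metricType R} {V : choiceType} {e : rel V}.
Context {len : V -> V -> R} {vtx : V -> T} {pt : V -> V -> R -> T}.
Hypothesis tree_e : combinatorial_tree e.
Hypothesis glue : tree_gluing e len vtx pt.
Hypothesis distE :
  forall x y : T, mdist x y = inf [set l | tree_path e len pt x y l].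
Context {r : V} {c : V -> seq V} (c_anc : ancestry (e := e) r c).

Lemma tree_path_ge0 x y l : tree_path e len pt x y l -> 0 <= l.
Proof. by elim=> // *; rewrite addr_ge0. Qed.

Lemma tree_dist_le x y l : tree_path e len pt x y l -> mdist x y <= l.
Proof.
move=> xyl; rewrite distE; apply: ge_inf => //; exists 0 => a.
exact: tree_path_ge0.
Qed.

(** A lower bound on the lengths of the paths bounds the distance, even without
    knowing in advance that some path exists. *)
Lemma tree_dist_ge x y a :
  (forall l, tree_path e len pt x y l -> a <= l) -> a <= mdist x y.
Proof.
move=> xya; have [[l xyl]|noxy] := pselect (exists l, tree_path e len pt x y l).
  by rewrite distE; apply: lb_le_inf => //; exists l.
(* The infimum of the empty set is 0, so two points which no path joins would
   be equal. *)
have xy0 : mdist x y = 0.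
  rewrite distE (_ : [set l | _] = set0) ?inf0//.
  by apply/seteqP; split=> // l xyl; case: noxy; exists l.
by case: noxy; exists 0; rewrite (mdist_positivity _ _ xy0); constructor.
Qed.

Lemma edge_dist_le u v s t : e u v -> s \in `[0, len u v] ->
  t \in `[0, len u v] -> mdist (pt u v s) (pt u v t) <= `|s - t|.
Proof.
move=> euv sI tI; apply: tree_dist_le; rewrite -[X in tree_path _ _ _ _ _ X]addr0.
by apply: TreePathCons => //; constructor.
Qed.

Lemma pt_len u v : e u v -> pt u v (len u v) = vtx v.
Proof.
move=> euv; have evu : e v u by rewrite (tree_sym tree_e).
rewrite -(pt_0 glue evu) -(pt_rev glue euv) ?subrr// in_itv /= lexx andbT.
exact: ltW (len_gt0 glue euv).
Qed.

(** Length of the chain of edges from [v] through the vertices of [p]. *)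
Fixpoint chain_length (v : V) (p : seq V) : R :=
  if p is u :: p' then len v u + chain_length u p' else 0.

(** Height of the vertex [v] above the root. *)
Definition height v : R := chain_length v (c v).

(** First point at height [t] met when going from [v] down through the vertices
    of [p], or else the last of these vertices. Positions on the edge from [v]
    to [u] are counted from the upper end point [v]. *)
Fixpoint chain_foot (t : R) (v : V) (p : seq V) : T :=
  if p is u :: p' then
    if chain_length u p' < t then pt v u (chain_length v p - t)
    else chain_foot t u p'
  else vtx v.

(** For [t <= height v], the point at height [t] on the way down from [v]; it is
    the root if [t <= 0]. *)
Definition foot t v : T := chain_foot t v (c v).

Lemma heightE v u p : c v = u :: p -> height v = len v u + height u.
Proof.
by move=> cv; have [_ cu] := ancestry_cons tree_e c_anc cv; rewrite /height cv cu.
Qed.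

Lemma footE t v u p : c v = u :: p ->
  foot t v = if height u < t then pt v u (height v - t) else foot t u.
Proof.
move=> cv; have [_ cu] := ancestry_cons tree_e c_anc cv.
by rewrite /foot /height cv cu.
Qed.

(** [x] lies on the half-open edge from [v] to its parent, at distance [s]
    from [v]. *)
Definition below (x : T) (v : V) (s : R) : Prop :=
  (x = vtx v /\ s = 0) \/
  exists u p, [/\ c v = u :: p, s \in `]0, len v u[ & x = pt v u s].

Lemma edge_pointP x :
  x = vtx r \/
  exists v u p s, [/\ c v = u :: p, s \in `[0, len v u] & x = pt v u s].
Proof.
case: (pt_surj glue x) => [[v ->]|[u [v [t [euv tI ->]]]]].
  case cv: (c v) => [|u p]; first by left; rewrite (ancestry_nil c_anc cv).
  have [evu _] := ancestry_cons tree_e c_anc cv.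
  right; exists v, u, p, 0; split; rewrite ?(pt_0 glue)// in_itv /= lexx.
  exact: ltW (len_gt0 glue evu).
right; case: (ancestry_edge tree_e c_anc euv) => [cv|cu].
  exists v, u, (c u), (len u v - t); rewrite (pt_rev glue)//; split=> //.
  by rewrite (len_sym glue euv); move: tI; rewrite !in_itv /=; lra.
by exists u, v, (c v), t.
Qed.

(** A point of the edge from [v] down to its parent [u] belongs to [v], except
    the lower end point, which belongs to [u]. *)
Lemma edge_below v u p s : c v = u :: p -> s \in `[0, len v u] ->
  below (pt v u s) v s \/ s = len v u /\ below (pt v u s) u 0.
Proof.
move=> cv; have [evu _] := ancestry_cons tree_e c_anc cv.
rewrite in_itv /= => /andP[s0 sl].
have [->|s_neq0] := eqVneq s 0; first by left; left; rewrite (pt_0 glue).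
have [->|s_neql] := eqVneq s (len v u).
  by right; split=> //; left; rewrite pt_len.
left; right; exists u, p; split=> //.
by rewrite in_itv /= !lt_neqAle eq_sym s_neq0 s0 s_neql.
Qed.

Lemma below_exists x : exists vs : V * R, below x vs.1 vs.2.
Proof.
have [->|[v [u [p [s [cv sI ->]]]]]] := edge_pointP x.
  by exists (r, 0); left.
by have [xv|[_ xu]] := edge_below cv sI; [exists (v, s)|exists (u, 0)].
Qed.

Lemma below_unique x v s v' s' : below x v s -> below x v' s' ->
  v = v' /\ s = s'.
Proof.
have vtx_inner w u p t w' : c w = u :: p -> t \in `]0, len w u[ ->
    pt w u t <> vtx w'.
  move=> cw tI; have [ewu _] := ancestry_cons tree_e c_anc cw.
  (* Some edge ends at w': the first one on the way to w, or the one from w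
     to u when w' = w. *)
  have [w'' e''] : exists w'', e w' w''.
    have [[|a q] /=] := tree_connected tree_e w' w.
      by move=> _ ->; exists u.
    by move=> /andP[ea _] _; exists a.
  rewrite -(pt_0 glue e'') => /(pt_inj glue ewu e'' tI).
  move: tI; rewrite !in_itv /= lexx (ltW (len_gt0 glue e'')) => /andP[t0 tl].
  by case=> // -[_ _]; lra.
move=> [[-> ->]|[u [p [cv sI ->]]]] [[xv' ->]|[u' [p' [cv' sI' xv']]]].
- by split=> //; exact: vtx_inj glue _ _ xv'.
- by case: (vtx_inner _ _ _ _ v cv' sI').
- by case: (vtx_inner _ _ _ _ v' cv sI).
have [evu cu] := ancestry_cons tree_e c_anc cv.
have [evu' cu'] := ancestry_cons tree_e c_anc cv'.
have sI'' : s' \in `[0, len v' u'] by apply: subset_itv_oo_cc.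
have [[-> _ ->]//|[vu uv _]] := pt_inj glue evu evu' sI sI'' xv'.
(* The remaining case would make v and u parents of each other. *)
have := congr1 size cv; have := congr1 size cv'.
by rewrite /= -cu' -cu vu uv => ->; lia.
Qed.

Lemma tree_hanging : exists (h : T -> R) p, hanging h p.
Proof.
have [f fP] := choice below_exists.
pose h x := height (f x).1 - (f x).2.
pose p t x := foot t (f x).1.
have belowE x v s : below x v s -> f x = (v, s).
  by move=> /(below_unique (fP x))[]; case: (f x) => a b /= -> ->.
have h_edge v u q s : c v = u :: q -> s \in `[0, len v u] ->
    h (pt v u s) = height v - s.
  move=> cv sI; rewrite /h.
  have [/belowE ->//|[-> /belowE ->]] := edge_below cv sI.
  by rewrite /= (heightE cv); lra.
have p_edge t v u q s : c v = u :: q -> s \in `[0, len v u] ->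
    t <= height v - s -> p t (pt v u s) = foot t v.
  move=> cv sI ts; rewrite /p.
  have [/belowE ->//|[sl /belowE ->]] := edge_below cv sI.
  rewrite /= (footE _ cv); case: ltP => // hu.
  by exfalso; move: ts; rewrite sl (heightE cv); lra.
have foot_vtx t v : t <= height v -> mdist (vtx v) (foot t v) <= height v - t.
  have [n] := ubnP (size (c v)); elim: n v => // n IH v.
  case cv: (c v) => [|u q] /=.
    by move=> _; rewrite /foot cv /= mdistxx subr_ge0.
  rewrite ltnS => qn tv.
  have [evu cu] := ancestry_cons tree_e c_anc cv.
  have len0 := len_gt0 glue evu; have hv := heightE cv.
  have I0 : 0 \in `[0, len v u] by rewrite in_itv /= lexx ltW.
  have Il : len v u \in `[0, len v u] by rewrite in_itv /= lexx ltW.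
  rewrite (footE _ cv) -(pt_0 glue evu); case: ltP => tu.
    have It : height v - t \in `[0, len v u] by rewrite in_itv /=; lra.
    apply: le_trans (edge_dist_le evu I0 It) _.
    by rewrite ler_norml; lra.
  apply: le_trans (metric_triangle _ (pt v u (len v u)) _) _.
  have := edge_dist_le evu I0 Il; rewrite sub0r normrN (gtr0_norm len0).
  rewrite pt_len// => d1; have := IH u; rewrite cu => /(_ qn tu).
  lra.
have p_dist t x : t <= h x -> mdist x (p t x) <= h x - t.
  have [->|[v [u [q [s [cv sI ->]]]]]] := edge_pointP x.
    have xr : below (vtx r) r 0 by left.
    by rewrite /h /p (belowE _ _ _ xr) /= subr0; exact: foot_vtx.
  rewrite (h_edge _ _ _ _ cv sI) => ts; rewrite (p_edge _ _ _ _ _ cv sI ts).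
  have [evu cu] := ancestry_cons tree_e c_anc cv.
  have len0 := len_gt0 glue evu; have hv := heightE cv.
  have Il : len v u \in `[0, len v u] by rewrite in_itv /= lexx ltW.
  move: (sI); rewrite in_itv /= => /andP[s0 sl].
  rewrite (footE _ cv); case: ltP => tu.
    have It : height v - t \in `[0, len v u] by rewrite in_itv /=; lra.
    apply: le_trans (edge_dist_le evu sI It) _.
    by rewrite ler_norml; lra.
  apply: le_trans (metric_triangle _ (pt v u (len v u)) _) _.
  have := edge_dist_le evu sI Il; rewrite distrC ger0_norm ?subr_ge0//.
  rewrite pt_len// => d1; have := foot_vtx t u tu.
  lra.
(* Along one edge, h is 1-Lipschitz and the feet are constant above each level. *)
have segment u v s t : e u v -> s \in `[0, len u v] -> t \in `[0, len u v] ->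
    `|h (pt u v s) - h (pt u v t)| <= `|s - t| /\
    forall a, a <= h (pt u v s) -> a <= h (pt u v t) ->
      p a (pt u v s) = p a (pt u v t).
  have down u' v' q s' t' : c u' = v' :: q -> s' \in `[0, len u' v'] ->
      t' \in `[0, len u' v'] ->
      `|h (pt u' v' s') - h (pt u' v' t')| <= `|s' - t'| /\
      forall a, a <= h (pt u' v' s') -> a <= h (pt u' v' t') ->
        p a (pt u' v' s') = p a (pt u' v' t').
    move=> cu sI tI; rewrite !(h_edge _ _ _ _ cu)//.
    split; last by move=> a sa ta; rewrite !(p_edge _ _ _ _ _ cu).
    have -> : height u' - s' - (height u' - t') = t' - s' by lra.
    by rewrite distrC.
  move=> euv sI tI; have [cv|cu] := ancestry_edge tree_e c_anc euv; last first.
    exact: down cu sI tI.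
  rewrite -(pt_rev glue euv sI) -(pt_rev glue euv tI).
  have -> : `|s - t| = `|(len u v - s) - (len u v - t)|.
    have -> : len u v - s - (len u v - t) = t - s by lra.
    by rewrite distrC.
  by apply: down cv _ _; rewrite (len_sym glue euv);
    move: sI tI; rewrite !in_itv /=; lra.
have h_path x y l : tree_path e len pt x y l -> `|h x - h y| <= l.
  elim=> [z|u v s t z m euv sI tI _ IH]; first by rewrite subrr normr0.
  have [hst _] := segment _ _ _ _ euv sI tI.
  by rewrite (le_trans (ler_distD (h (pt u v t)) _ _))// lerD.
exists h, p; split=> // [x y|t x y tx ty pxy].
  by apply: tree_dist_ge => l; exact: h_path.
apply: tree_dist_ge => l xyl; elim: xyl tx ty pxy => // {x y l}.
move=> u v s b y l euv sI bI path_y IH tx ty pxy.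
have [hsb psb] := segment _ _ _ _ euv sI bI.
have := h_path _ _ _ path_y.
move: hsb; rewrite !ler_norml => /andP[hsb1 hsb2] /andP[hy1 hy2].
have [tb|tb] := leP t (h (pt u v b)); last by lra.
have := IH tb ty; rewrite -(psb t tx tb) => /(_ pxy); lra.
Qed.

End TreeHanging.

Lemma is_tree_hanging (R : realType) (T : metricType R) :
  is_tree T -> exists (h : T -> R) p, hanging h p.
Proof.
move=> [V [e [len [vtx [pt [tree_e glue distE]]]]]].
have [r _] := tree_nonempty tree_e.
have [c c_anc] := exists_ancestry tree_e r.
exact: (tree_hanging tree_e glue distE c_anc).
Qed.

(** * Lipschitz maps, Borel sets and diameters *)

Lemma lipschitz1_continuous (R : realType) (X Y : metricType R) (f : X -> Y) :
  lipschitz1 f -> continuous f.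
Proof.
move=> f_lip x; apply/(@metricType_numDomainType.cvgrPdist_lt R Y) => eps eps0.
apply/metricType_numDomainType.nbhs_mdistP; exists eps => //= y.
exact: le_lt_trans.
Qed.

Lemma borel_preimage (X Y : topologicalType) (f : X -> Y) (A : set Y) :
  continuous f -> borel A -> borel (f @^-1` A).
Proof.
move=> f_cont; apply: (@smallest_sub _ _ _ [set B | borel (f @^-1` B)]).
  have [b0 bC bU] := @smallest_sigma_algebra X [set: X] open.
  split=> /=; first by rewrite preimage_set0.
    by move=> B /bC; rewrite !setTD preimage_setC.
  by move=> F FB; rewrite preimage_bigcup; exact: bU.
move=> B oB; apply: sub_sigma_algebra.
by move: B oB; exact/continuousP.
Qed.

Lemma mdist_diam (R : realType) (Y : metricType R) (A : set Y) x y :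
  A x -> A y -> ((mdist x y)%:E <= diam A)%E.
Proof. by move=> Ax Ay; apply: ereal_sup_ubound; right; exists x => //; exists y. Qed.

Lemma diam_le (R : realType) (Y : metricType R) (A : set Y) (a : R) :
  0 <= a -> (forall x y, A x -> A y -> mdist x y <= a) -> (diam A <= a%:E)%E.
Proof.
move=> a0 Aa; apply: ge_ereal_sup => _ [->|[x Ax [y Ay <-]]].
  by rewrite lee_fin.
by rewrite lee_fin Aa.
Qed.

(** * The signed height *)

Section SignedHeight.
Context {R : realType} {T : metricType R} {h : T -> R} {p : R -> T -> T}.
Hypothesis hp : hanging h p.

(** Height above the level [t], counted positively on the branches with foot
    in [L] and negatively on the others. It is 0 below the level [t], where
    [p t x] has no meaning. *)
Definition signed_height (t : R) (L : set T) (x : T) : R :=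
  if p t x \in L then Num.max (h x - t) 0 else - Num.max (h x - t) 0.

(** Passing from one branch to another one goes through the level [t], where
    the signed height vanishes. *)
Lemma signed_height_lipschitz t L :
  lipschitz1 (signed_height t L : T -> (R^o : metricType R)).
Proof.
have [h_lip _ p_sep] := hp.
move=> x y; rewrite {1}/mdist /= /signed_height.
have := h_lip x y; have := mdist_ge0 x y.
rewrite ler_norml => d0 /andP[d1 d2].
have [tx|tx] := ltP (h x - t) 0; have [ty|ty] := ltP (h y - t) 0;
  have [xL|xL] := boolP (p t x \in L); have [yL|yL] := boolP (p t y \in L);
  rewrite ler_norml; try lra.
- suff : h x - t + (h y - t) <= mdist x y by lra.
  apply: p_sep; [lra|lra|by move=> pxy; move: yL; rewrite -pxy xL].
- suff : h x - t + (h y - t) <= mdist x y by lra.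
  apply: p_sep; [lra|lra|by move=> pxy; move: xL; rewrite pxy yL].
Qed.

End SignedHeight.

(** * Concentration on one branch *)

(** If each member of an exhaustion of [S] has mass at most [k], or its
    complement in [S] does, then one step of the exhaustion carries all the mass
    of [S] but at most [2 * k]: the first one at which the mass exceeds [k], if
    any. *)
Lemma exhaustion_big_step (R : realType) (d : measure_display)
    (T : measurableType d) (mu : {finite_measure set T -> \bar R})
    (S : set T) (F : nat -> set T) (k : R) :
  0 <= k -> measurable S -> (forall n, measurable (F n)) ->
  nondecreasing_seq F -> F 0%N = set0 -> \bigcup_n F n = S ->
  (forall n, (mu (F n) <= k%:E)%E \/ (mu (S `\` F n) <= k%:E)%E) ->
  exists n, (mu S - (2 * k)%:E <= mu (F n.+1 `\` F n))%E.
Proof.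
move=> k0 mS mF ndF F0 FS dich.
have finE A : measurable A -> mu A = (fine (mu A))%:E.
  by move=> mA; rewrite fineK// fin_num_measure.
have [Sk|kS] := leP (mu S) k%:E.
  exists 0%N; apply: le_trans (measure_ge0 mu _).
  rewrite leeBlDr// add0e; apply: le_trans Sk _; rewrite lee_fin; lra.
have [n kFn] : exists n, (k%:E < mu (F n))%E.
  have := @nondecreasing_cvg_mu _ _ _ mu F mF; rewrite FS => /(_ mS ndF).
  move=> /(_ [set y | (k%:E < y)%E]) []; first exact: open_ereal_gt'.
  by move=> n _ /(_ n (leqnn n)) kFn; exists n.
have [[|m] kFm min_m] := ex_minnP (ex_intro (fun n => (k%:E < mu (F n))%E) n kFn).
  by move: kFm; rewrite F0 measure0 lte_fin ltNge k0.
exists m.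
have Fm : (mu (F m) <= k%:E)%E.
  by rewrite leNgt; apply/negP => /min_m; rewrite ltnn.
have SFm : (mu (S `\` F m.+1) <= k%:E)%E.
  by case: (dich m.+1) => //; rewrite leNgt kFm.
have mD : measurable (F m.+1 `\` F m) by exact: measurableD.
have mE : measurable (S `\` F m.+1) by exact: measurableD.
have mU := measurableU _ _ (mF m) mD.
have cover : (mu S <= mu (F m) + mu (F m.+1 `\` F m) + mu (S `\` F m.+1))%E.
  apply: le_trans (leeD2r _ (measureU2 mu (mF m) mD)).
  apply: le_trans (measureU2 mu mU mE).
  apply: le_measure; rewrite ?inE//; first exact: measurableU.
  move=> x Sx; have [F1|F1] := pselect (F m.+1 x); last by right.
  by left; have [F2|F2] := pselect (F m x); [left|right].
move: cover Fm SFm; rewrite (finE _ mS) (finE _ (mF m)) (finE _ mD) (finE _ mE).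
by rewrite leeBlDr// -!EFinD !lee_fin; lra.
Qed.

(** Outside a set of mass at most [k], a 1-Lipschitz function oscillates by less
    than [eps], as soon as the observable diameter is less than [eps]. *)
Lemma obs_diam_concentration (R : realType) (X : mm_space R) (k eps : R)
    (g : X -> (R^o : metricType R)) :
  (obs_diam X (R^o : metricType R) k < eps%:E)%E -> lipschitz1 g ->
  exists S : set X, [/\ borel S,
    (mm_measure X setT - k%:E <= mm_measure X S)%E &
    forall x y, S x -> S y -> `|g x - g y| < eps].
Proof.
move=> obs_lt g_lip.
have : (partial_diam (fun A : set (R^o : metricType R) =>
    mm_measure X (g @^-1` A)) k < eps%:E)%E.
  by apply: le_lt_trans obs_lt; apply: ereal_sup_ubound; exists g.
move=> /ereal_inf_lt[_ [A [bA muA] <-] diamA].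
exists (g @^-1` A); split=> //.
  exact: borel_preimage (lipschitz1_continuous g_lip) bA.
move=> x y gx gy; rewrite -lte_fin distrC.
apply: le_lt_trans diamA.
exact: (@mdist_diam R (R^o : metricType R) A _ _ gx gy).
Qed.

(** Concentration of real functions up to mass [k] gives concentration of maps to
    a hanging space up to mass [3 * k]. *)
Lemma hanging_partial_diam (R : realType) (X : mm_space R) (T : metricType R)
    (h : T -> R) (p : R -> T -> T) (f : X -> T) (k eps : R) :
  hanging h p -> lipschitz1 f -> 0 < k -> 0 < eps ->
  (obs_diam X (R^o : metricType R) k < eps%:E)%E ->
  (partial_diam (fun A : set T => mm_measure X (f @^-1` A)) (3 * k)
    <= (8 * eps)%:E)%E.
Proof.
move=> hp f_lip k_gt0 eps_gt0 obs_lt.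
pose mu := mm_measure X; pose Xm := g_sigma_algebraType (@open X).
have [h_lip p_dist p_sep] := hp.
have finE (A : set Xm) : measurable A -> mu A = (fine (mu A))%:E.
  by move=> mA; rewrite fineK// fin_num_measure.
have mT : measurable [set: Xm] by exact: measurableT.
have hf_lip : lipschitz1 (h \o f : X -> (R^o : metricType R)).
  move=> x y; apply: le_trans (f_lip x y); rewrite {1}/mdist /= distrC.
  exact: h_lip.
have [S [bS muS S_eps]] := obs_diam_concentration obs_lt hf_lip.
have mS : @measurable _ Xm S by [].
have witness (A : set T) : borel A -> (diam A <= (8 * eps)%:E)%E ->
    (mu setT - (3 * k)%:E <= mu (f @^-1` A))%E ->
    (partial_diam (fun A : set T => mm_measure X (f @^-1` A)) (3 * k)
      <= (8 * eps)%:E)%E.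
  by move=> bA dA muA; apply: le_trans dA; apply: ereal_inf_lbound; exists A.
have [[x0 Sx0]|S0] := pselect (S !=set0); last first.
  apply: (witness set0); first exact: (@sigma_algebra0 _ setT).
    by apply: diam_le => //; rewrite mulr_ge0// ltW.
  have SE : S = set0 by apply/seteqP; split=> // x Sx; case: S0; exists x.
  move: muS; rewrite SE preimage_set0 -/mu measure0 (finE _ mT).
  by rewrite !leeBlDr// !add0e !lee_fin; lra.
(* With this level, S lies strictly between eps and 3 eps above it. *)
pose t := h (f x0) - 2 * eps.
have S_h x : S x -> eps < h (f x) - t < 3 * eps.
  move=> Sx; have := S_eps x x0 Sx Sx0.
  by rewrite /t /= ltr_norml => /andP[? ?]; apply/andP; split; lra.
pose label x := p t (f x).
pose sg L := signed_height (h := h) (p := p) t L \o f.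
have sg_lip L : lipschitz1 (sg L : X -> (R^o : metricType R)).
  move=> x y; apply: le_trans (f_lip x y).
  exact: (signed_height_lipschitz hp).
have sg_in L x : S x -> L (label x) -> eps < sg L x.
  move=> Sx Lx; have := S_h x Sx; rewrite /sg /= /signed_height mem_set//.
  by case: (ltP (h (f x) - t) 0); lra.
have sg_out L x : S x -> ~ L (label x) -> sg L x < - eps.
  move=> Sx Lx; have := S_h x Sx; rewrite /sg /= /signed_height memNset//.
  by case: (ltP (h (f x) - t) 0); lra.
pose SL L := S `&` [set x | L (label x)].
have mSL L : @measurable _ Xm (SL L).
  have -> : SL L = S `&` (sg L @^-1` [set y : R | 0 < y]).
    apply/seteqP; split=> x [Sx].
      by move=> /(sg_in _ _ Sx) /= lt; split=> //=; lra.
    move=> /= lt; split=> //=; apply: contrapT => /(sg_out _ _ Sx); lra.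
  apply: measurableI => //; apply: sub_sigma_algebra.
  move: (lipschitz1_continuous (sg_lip L)) => /continuousP; apply.
  exact: open_gt.
(* The branches with feet in L, or the other ones, have mass at most k, because
   the signed height jumps by more than 2 eps between them. *)
have dich L : (mu (SL L) <= k%:E)%E \/ (mu (S `\` SL L) <= k%:E)%E.
  have [B [bB muB B_eps]] := obs_diam_concentration obs_lt (sg_lip L).
  have mB : @measurable _ Xm B by [].
  have small (A : set Xm) : measurable A -> A `&` B = set0 -> (mu A <= k%:E)%E.
    move=> mA AB0.
    have le1 : (mu A + mu B <= mu setT)%E.
      rewrite -[leLHS]measureU//; apply: le_measure; rewrite ?inE//.
      exact: measurableU.
    move: muB le1; rewrite -/mu (finE _ mT) (finE _ mA) (finE _ mB).
    by rewrite leeBlDr// -!EFinD !lee_fin; lra.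
  have [[x [[Sx Lx] Bx]]|noB] := pselect (SL L `&` B !=set0).
    right; apply: small; first exact: measurableD.
    apply/seteqP; split=> // y [[Sy nLy] By] /=.
    have Ly : ~ L (label y) by move=> Ly; apply: nLy.
    have := B_eps _ _ Bx By; rewrite ltr_norml => /andP[_].
    by have := sg_in _ _ Sx Lx; have := sg_out _ _ Sy Ly; lra.
  left; apply: small => //; apply/seteqP; split=> // y yB.
  by case: noB; exists y.
have same_label x y : S x -> S y -> mdist x y < 2 * eps -> label x = label y.
  move=> Sx Sy xy; apply: contrapT => nl; have := f_lip x y.
  have /andP[hx _] := S_h _ Sx; have /andP[hy _] := S_h _ Sy.
  have : h (f x) - t + (h (f y) - t) <= mdist (f x) (f y).
    by apply: p_sep => //; lra.
  lra.
have [D /countable_injP[j j_inj] denseD] := mm_separable X.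
(* L n is the set of feet of the branches which come within eps of one of the
   first n points of the dense set D. One point is that close to at most one
   branch, so L n.+1 has at most one foot more than L n. *)
pose L n := [set q | exists x d, [/\ S x, D d, (j d < n)%N, mdist x d < eps &
  q = label x]].
have [n muFn] : exists n,
    (mu S - (2 * k)%:E <= mu (SL (L n.+1) `\` SL (L n)))%E.
  apply: exhaustion_big_step => //; first exact: ltW.
  - move=> m n mn; apply/subsetPset => x [Sx [y [d [Sy Dd jd yd xy]]]].
    by split=> //; exists y, d; split=> //; exact: leq_trans jd mn.
  - by apply/seteqP; split=> // x [_ [y [d []]]].
  - apply/seteqP; split=> [x [n _ []]//|x Sx].
    have [||d [/interior_subset + Dd]] := denseD (ball x eps)^°.
    - by exists x; exact: nbhsx_ballx.
    - exact: open_interior.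
    rewrite ballEmdist /= => xd.
    by exists (j d).+1 => //; split=> //; exists x, d.
have [q qP] : exists q, forall x, (SL (L n.+1) `\` SL (L n)) x -> label x = q.
  have [[x Cx]|C0] := pselect (SL (L n.+1) `\` SL (L n) !=set0); last first.
    by exists (f x0) => x Cx; case: C0; exists x.
  have near_dn z : (SL (L n.+1) `\` SL (L n)) z -> exists y d,
      [/\ S y, D d, j d = n, mdist y d < eps & label z = label y].
    move=> [[Sx' [y [d [Sy Dd jd yd xy]]]] nx]; exists y, d; split=> //.
    apply/eqP; rewrite eqn_leq -ltnS jd leqNgt; apply/negP => jdn.
    by apply: nx; split=> //; exists y, d.
  have [y [d [Sy Dd jd yd xy]]] := near_dn x Cx.
  exists (label x) => x' /near_dn[y' [d' [Sy' Dd' jd' yd' xy']]].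
  rewrite xy xy'; apply: same_label => //.
  have dd' : d' = d by apply: j_inj; rewrite ?inE// jd jd'.
  rewrite dd' metric_sym in yd'.
  by have := metric_triangle y' d y; rewrite (metric_sym y' d) (metric_sym d y); lra.
(* A consists of the points with foot q between the levels t and t + 4 eps. *)
pose A := [set y | 0 < signed_height (h := h) (p := p) t [set q] y < 4 * eps].
have A_h y : A y -> p t y = q /\ 0 < h y - t < 4 * eps.
  rewrite /A /= /signed_height; case: ifPn => [|_].
    by rewrite inE => -> yt; split=> //; move: yt; case: (ltP (h y - t) 0); lra.
  by move=> yt; exfalso; move: yt; case: (ltP (h y - t) 0); lra.
have oA : open A.
  have -> : A = signed_height (h := h) (p := p) t [set q] @^-1`
      ([set y : R | 0 < y] `&` [set y | y < 4 * eps]).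
    by apply/seteqP; split=> y; [move=> /andP|move=> ?; apply/andP].
  move: (lipschitz1_continuous (signed_height_lipschitz hp t [set q])).
  by move=> /continuousP; apply; apply: openI; [exact: open_gt|exact: open_lt].
apply: (witness A); first exact: sub_sigma_algebra.
  apply: diam_le => [|x y /A_h[xq /andP[x1 x2]] /A_h[yq /andP[y1 y2]]].
    by rewrite mulr_ge0// ltW.
  have := p_dist t x; rewrite xq => /(_ ltac:(lra)) dx.
  have := p_dist t y; rewrite yq => /(_ ltac:(lra)) dy.
  have := metric_triangle x q y; rewrite (metric_sym q y); lra.
have mC : @measurable _ Xm (SL (L n.+1) `\` SL (L n)) by exact: measurableD.
have mA : @measurable _ Xm (f @^-1` A).
  apply: (borel_preimage (lipschitz1_continuous f_lip)).
  exact: sub_sigma_algebra.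
have CA : (mu (SL (L n.+1) `\` SL (L n)) <= mu (f @^-1` A))%E.
  apply: le_measure; rewrite ?inE// => x Cx; have [[Sx _] _] := Cx.
  have := S_h x Sx; rewrite /A /= /signed_height -/(label x) (qP x Cx).
  by rewrite mem_set//; case: (ltP (h (f x) - t) 0); lra.
move: muS muFn CA; rewrite -/mu (finE _ mT) (finE _ mS) (finE _ mC) (finE _ mA).
by rewrite !leeBlDr// -!EFinD !lee_fin; lra.
Qed.

(** * The one-point tree and the limit *)

(** The one-point metric space. *)
Definition one_point (R : realType) : Type := unit.

Section OnePoint.
Variable R : realType.

Let dist (x y : one_point R) : R := 0.
Let dist_positivity (x y : one_point R) : dist x y = 0 -> x = y.
Proof. by case: x; case: y. Qed.
Let dist_triangle (y x z : one_point R) : dist x z <= dist x y + dist y z.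
Proof. by rewrite addr0. Qed.

HB.instance Definition _ := Choice.on (one_point R).
HB.instance Definition _ := isMetric.Build R (one_point R)
  (fun=> erefl) dist_positivity (fun _ _ => erefl) dist_triangle.

End OnePoint.

Lemma one_point_is_tree (R : realType) : is_tree (one_point R : metricType R).
Proof.
exists unit, (fun _ _ => false), (fun _ _ => 0), (fun=> tt), (fun _ _ _ => tt).
split.
- split=> //; first by exists tt.
  + by move=> [] []; exists [::].
  + by case=> [|? []].
- split=> //; first by move=> [] [].
  by case; left; exists tt.
move=> x y; apply/eqP; rewrite eq_le; apply/andP; split.
  apply: lb_le_inf; last by move=> l /tree_path_ge0.
  by exists 0; case: x y => [] []; constructor.
apply: ge_inf; last by case: x y => [] []; constructor.
by exists 0 => l /tree_path_ge0.
Qed.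

Lemma obs_diam_ge0 (R : realType) (X : mm_space R) (Y : metricType R)
    (y : Y) (k : R) : (0 <= obs_diam X Y k)%E.
Proof.
apply: (@le_trans _ _ (partial_diam
    (fun A : set Y => mm_measure X ((fun=> y) @^-1` A)) k)).
  by apply: le_ereal_inf_tmp => _ [A _ <-]; apply: ereal_sup_ubound; left.
apply: ereal_sup_ubound; exists (fun=> y) => // x x'.
by rewrite mdistxx mdist_ge0.
Qed.

Theorem proposition1p8 (R : realType) (X : nat -> mm_space R)
    (X_levy : levy_family X) (kappa : R) (kappa_gt0 : 0 < kappa) :
  ereal_sup [set D | exists2 T : metricType R,
                       is_tree T & D = obs_diam (X n) T kappa] @[n --> \oo]
    --> 0%E.
Proof.
move=> P /nbhs_EFin/nbhs_ballP[delta /= delta0 ballP].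
(* The mass defect is multiplied by 3 and the size by 8; the bound delta / 2
   is strictly less than delta. *)
have k0 : 0 < kappa / 3 by rewrite divr_gt0.
have eps0 : 0 < delta / 16 by rewrite divr_gt0.
have : \forall n \near \oo,
    (obs_diam (X n) (R^o : metricType R) (kappa / 3) < (delta / 16)%:E)%E.
  apply: (X_levy _ k0 [set y | (y < (delta / 16)%:E)%E]).
  exact: open_ereal_lt'.
apply: filterS => n obs_lt /=; set D := ereal_sup _.
have D_ge0 : (0 <= D)%E.
  apply: le_trans (obs_diam_ge0 (X n) (tt : one_point R) kappa) _.
  apply: ereal_sup_ubound; exists (one_point R : metricType R) => //.
  exact: one_point_is_tree.
have D_le : (D <= (8 * (delta / 16))%:E)%E.
  apply: ge_ereal_sup => _ [T T_tree ->]; apply: ge_ereal_sup => _ [f f_lip <-].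
  have [h [p hp]] := is_tree_hanging T_tree.
  have := hanging_partial_diam hp f_lip k0 eps0 obs_lt.
  by rewrite mulrCA divff// mulr1.
move: D D_ge0 D_le => [d| |]//; rewrite !lee_fin => d0 d_le.
apply: ballP; rewrite /ball /= sub0r normrN ger0_norm//; lra.
Qed.
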